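(* Let $X_1,X_2,\dotsc$ be independent and identically distributed real random variables on a probability space $(\Omega,\mathcal{F},P)$. Suppose that there exist reals $a$ and $b$ with $a<b$ such that $a\le X_1\le b$ holds almost surely. Consider the following property of $\omega\in\Omega$: for every real $t>2$ there exists $M\in\mathbb{N}^+$ such that for every integer $n\ge M$ and every $k\in\mathbb{N}^+$, if $k\ge n^t$ then $$\left|\frac{1}{k}\sum_{i=1}^k X_i(\omega)-E[X_1]\right|<\frac{1}{n}.$$ Then the set of $\omega\in\Omega$ with this property is $\mathcal{F}$-measurable, and the property holds almost surely.
   Context: $\mathbb{N}^+$ is the set of positive integers. $(\Omega,\mathcal{F},P)$ is a general probability space (no computability assumption), and $E[X]$ denotes the mean of a random variable $X$. *)

(* Defs.v *)
From HB Require Import structures.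
From mathcomp Require Import all_boot all_order all_algebra finmap.
From mathcomp Require Import all_classical all_reals all_analysis.

Set Implicit Arguments.
Unset Strict Implicit.
Unset Printing Implicit Defensive.

Import Order.TTheory GRing.Theory Num.Theory.
Import numFieldNormedType.Exports.

Local Open Scope classical_set_scope.
Local Open Scope ring_scope.

Definition mutually_independent d (T : measurableType d) (R : realType)
    (P : probability T R) (I : choiceType) (X : I -> {RV P >-> R}) : Prop :=
  forall (J : {fset I}) (B : I -> set R),
    (forall i, i \in J -> measurable (B i)) ->
    P (\bigcap_(i in [set` J]) (X i @^-1` B i)) =
      (\prod_(i <- J) P (X i @^-1` B i))%E.

(* Laws are compared on measurable sets only: as a function, [distribution] is
   also defined on the other sets, where its values mean nothing. *)
Definition identically_distributed d (T : measurableType d) (R : realType)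
    (P : probability T R) (I : Type) (X : I -> {RV P >-> R}) : Prop :=
  forall (i j : I) (B : set R), measurable B ->
    distribution P (X i) B = distribution P (X j) B.

(* Sequences indexed from 1 in the mathematics are indexed from 0 here: [x i]
   is the term of index i + 1, so [\sum_(i < k) x i] has the first k terms. *)
Definition averages_converge_fast (R : realType) (x : nat -> R) (m : R) : Prop :=
  forall t : R, 2 < t ->
    exists M : nat, (0 < M)%N /\
      forall n k : nat, (M <= n)%N -> (0 < k)%N -> n%:R `^ t <= k%:R ->
        `| k%:R^-1 * (\sum_(i < k) x i) - m | < n%:R^-1.

(* Main.v *)
(* Clip the variables to [a, b]; this changes them on a null set only. A
   Chernoff bound then gives
     P (|S_k| >= k e) <= 2 exp (- k e^2 / (8 c^2))
   for the centred sums S_k. With e = k^(-1/t) the exponent is of order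
   k^(1 - 2/t), which is summable because t > 2, so by Borel-Cantelli almost
   surely |S_k / k| < k^(-1/t) for all large k, and k >= n^t makes this at most
   1/n. The property for t implies it for all larger t, so the countably many
   exponents 2 + 1/(j+1) suffice; this also gives measurability. *)
Require Import Defs.
From HB Require Import structures.
From mathcomp Require Import all_boot all_order all_algebra finmap.
From mathcomp Require Import all_classical all_reals all_analysis.
From mathcomp Require Import measurable_realfun.
From mathcomp Require Import ring lra.

Set Implicit Arguments.
Unset Strict Implicit.
Unset Printing Implicit Defensive.

Import Order.TTheory GRing.Theory Num.Theory.
Import numFieldNormedType.Exports.
Import HBNNSimple.

Local Open Scope classical_set_scope.
Local Open Scope ring_scope.

(** * Expectation of a product of functions of independent variables *)

(** The right side sees [V] only through integrals against indicators of [X], which is what allows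
    two weights to be compared. Monotone convergence along the simple approximations of [f] gives
    the limit, and linearity splits each of them into level sets. *)
Lemma integral_comp_mul_approx d d' (T : measurableType d)
    (T' : measurableType d') (R : realType)
    (mu : {measure set T -> \bar R}) (X : {mfun T >-> T'}) (V : T -> R)
    (f : T' -> \bar R) (mf : measurable_fun [set: T'] f) :
  measurable_fun [set: T] V -> (forall w, 0 <= V w) -> (forall x, 0 <= f x)%E ->
  let g := nnsfun_approx measurableT mf in
  (\int[mu]_w (f (X w) * (V w)%:E))%E = limn (fun n => \sum_(r \in range (g n))
     (r%:E * \int[mu]_w (\1_(g n @^-1` [set r]) (X w) * V w)%:E))%E.
Proof.
move=> mV V0 f0 g.
have mgX n : measurable_fun [set: T] (fun w => (g n (X w))).
  exact: measurableT_comp.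
transitivity (limn (fun n => \int[mu]_w ((g n (X w))%:E * (V w)%:E))%E).
  rewrite -monotone_convergence//.
  - apply: eq_integral => w _.
    apply/esym/cvg_lim => //; apply: cvgeZr => //.
    exact: cvg_nnsfun_approx.
  - by move=> n; apply: emeasurable_funM; apply/measurable_EFinP.
  - by move=> n w _; rewrite mule_ge0// lee_fin.
  - move=> w _ m n mn; rewrite lee_wpmul2r ?lee_fin//.
    by apply/lefP/nd_nnsfun_approx.
congr (limn _); apply/funext => n.
under eq_integral => w _.
  rewrite fimfunE -fsumEFin// ge0_mule_fsuml; last first.
    by move=> r; rewrite EFinM nnfun_muleindic_ge0.
  over.
have mI (r : R) : measurable_fun [set: T]
    (fun w => \1_(g n @^-1` [set r]) (X w) * V w).
  apply: measurable_funM => //.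
  by apply: (@measurableT_comp _ _ _ _ _ _ (\1_(g n @^-1` [set r]) : T' -> R)).
rewrite ge0_integral_fsum//; last 2 first.
- move=> r; under eq_fun do rewrite -EFinM -mulrA.
  by apply/measurable_EFinP; apply: measurable_funM.
- move=> r w _; rewrite mule_ge0// ?lee_fin//.
  by rewrite -lee_fin EFinM nnfun_muleindic_ge0.
apply: eq_fsbigr => r /set_mem[x _ <-].
under eq_integral do rewrite -EFinM -mulrA EFinM.
rewrite ge0_integralZl ?lee_fin//.
- exact/measurable_EFinP.
- by move=> w _; rewrite lee_fin mulr_ge0.
Qed.

(** Both sides are limits of the same combinations of indicator integrals. The use is with [W]
    constant, which pulls the remaining factors out of an expectation. *)
Lemma eq_integral_comp_mul d d' (T : measurableType d)
    (T' : measurableType d') (R : realType)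
    (mu : {measure set T -> \bar R}) (X : {mfun T >-> T'}) (V W : T -> R)
    (f : T' -> \bar R) :
  measurable_fun [set: T'] f -> (forall x, 0 <= f x)%E ->
  measurable_fun [set: T] V -> (forall w, 0 <= V w) ->
  measurable_fun [set: T] W -> (forall w, 0 <= W w) ->
  (forall B, measurable B -> \int[mu]_w (\1_B (X w) * V w)%:E =
                             \int[mu]_w (\1_B (X w) * W w)%:E)%E ->
  (\int[mu]_w (f (X w) * (V w)%:E) = \int[mu]_w (f (X w) * (W w)%:E))%E.
Proof.
move=> mf f0 mV V0 mW W0 VW.
rewrite !(@integral_comp_mul_approx _ _ _ _ _ _ _ _ _ mf)//.
congr (limn _); apply/funext => n; apply: eq_fsbigr => r _.
by rewrite VW.
Qed.

Lemma prod_indic (T : Type) (R : realType) (I : choiceType) (J : {fset I})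
    (A : I -> set T) w :
  \prod_(i <- J) (\1_(A i) w : R) = \1_(\bigcap_(i in [set` J]) A i) w.
Proof.
rewrite indicE; have [|] := boolP (w \in _).
  move=> /set_mem Aw; rewrite big_seq big1// => i iJ.
  by rewrite indicE mem_set//; apply: Aw.
move=> /negP nA; have [i [iJ nAi]] : exists i, i \in J /\ ~ A i w.
  apply: contrapT => h; apply: nA; apply/mem_set => i /= iJ.
  by apply: contrapT => nAi; apply: h; exists i.
rewrite (bigD1_seq i)//= indicE memNset ?mul0r//.
Qed.

Lemma integral_indic_comp d d' (T : measurableType d) (T' : measurableType d')
    (R : realType) (mu : {measure set T -> \bar R}) (X : {mfun T >-> T'}) B :
  measurable B -> (\int[mu]_w (\1_B (X w))%:E = mu (X @^-1` B))%E.
Proof.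
move=> mB; have mXB : measurable (X @^-1` B).
  exact: measurable_funPTI.
by rewrite -[in RHS](setIT (_ @^-1` _)) -integral_indic.
Qed.

(** Induction on a list [s] of indices whose factors may be arbitrary, the other factors being
    indicators; for empty [s] this is independence itself. For a new index [j], the product [V] of
    the other factors integrates like the constant [c] against every [\1_B (X j w)], hence also
    against [f j (X j w)]. *)
Lemma expectation_prod d (T : measurableType d) (R : realType)
    (P : probability T R) (I : choiceType) (X : I -> {RV P >-> R})
    (f : I -> R -> R) (J : {fset I}) :
  mutually_independent X ->
  (forall i, measurable_fun [set: R] (f i)) -> (forall i x, 0 <= f i x) ->
  (forall i, \int[P]_w (f i (X i w))%:E \is a fin_num)%E ->
  (\int[P]_w (\prod_(i <- J) f i (X i w))%:E =
   \prod_(i <- J) \int[P]_w (f i (X i w))%:E)%E.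
Proof.
move=> indep.
have mindic (B : set R) :
  measurable B -> measurable_fun [set: R] (\1_B : R -> R) by [].
suff H (s : seq I) : forall f : I -> R -> R,
  (forall i, measurable_fun [set: R] (f i)) -> (forall i x, 0 <= f i x) ->
  (forall i, \int[P]_w (f i (X i w))%:E \is a fin_num)%E ->
  (forall i, i \in J -> i \notin s -> exists2 B, measurable B & f i = \1_B) ->
  (\int[P]_w (\prod_(i <- J) f i (X i w))%:E =
   \prod_(i <- J) \int[P]_w (f i (X i w))%:E)%E.
  by move=> mf f0 ff; apply: (H (J : seq I)) => // i ->.
(* Indicators are exchanged for general functions one index of s at a time. *)
elim: s => [|j s IH] {}f mf f0 ff fB.
  have fB' i : i \in J -> {B | measurable B & f i = \1_B}.
    by move=> iJ; apply: cid2; exact: fB.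
  (* Outside [J] the value [set0] is only a default. *)
  pose B i := if pselect (i \in J) is left iJ then s2val (fB' i iJ) else set0.
  have mB i : i \in J -> measurable (B i).
    by move=> iJ; rewrite /B; case: pselect => // iJ'; case: (fB' i iJ').
  have fE i : i \in J -> f i = \1_(B i).
    by move=> iJ; rewrite /B; case: pselect => // iJ'; case: (fB' i iJ').
  have mXB i : i \in J -> measurable (X i @^-1` B i).
    by move=> /mB; exact: measurable_funPTI.
  transitivity
      (\int[P]_w (\1_(\bigcap_(i in [set` J]) (X i @^-1` B i)) w)%:E)%E.
    apply: eq_integral => w _; rewrite -prod_indic; congr (_%:E).
    by apply: eq_big_seq => i iJ; rewrite fE.
  rewrite integral_indic// ?setIT; last exact: fin_bigcap_measurable.
  apply: etrans (indep J B mB) _; apply: eq_big_seq => i iJ.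
  by rewrite fE// integral_indic_comp//; exact: mB.
have [jJ|jJ] := boolP (j \in J); last first.
  apply: IH => // i iJ si; apply: fB => //; rewrite inE negb_or si andbT.
  by apply: contraNneq jJ => <-.
set c := (\prod_(i <- J | i != j) \int[P]_w (f i (X i w))%:E)%E.
have c0 : (0 <= c)%E.
  by apply: prode_ge0 => i _; apply: integral_ge0 => w _; rewrite lee_fin.
(* Finiteness lets the real number [fine c] serve as a weight in place of [V]. *)
have cfin : c \is a fin_num.
  apply: prode_fin_num => i _ //.
pose V w := \prod_(i <- J | i != j) f i (X i w).
have mfX i : measurable_fun [set: T] (fun w => f i (X i w)).
  exact: measurableT_comp.
have mV : measurable_fun [set: T] V.
  rewrite /V; under eq_fun do rewrite -big_filter; exact: measurable_prod.
have V0 w : 0 <= V w by exact: prodr_ge0.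
have VB B : measurable B -> (\int[P]_w (\1_B (X j w) * V w)%:E =
                             \int[P]_w (\1_B (X j w) * fine c)%:E)%E.
  move=> mB.
  (* With an indicator at [j], only indices of [s] carry arbitrary factors, so the induction
     hypothesis covers [g]. *)
  pose g i := if i == j then (\1_B : R -> R) else f i.
  have gi i : i != j -> g i = f i by rewrite /g => /negbTE ->.
  have gj : g j = \1_B by rewrite /g eqxx.
  have : (\int[P]_w (\prod_(i <- J) g i (X i w))%:E =
   \prod_(i <- J) \int[P]_w (g i (X i w))%:E)%E.
    apply: IH => //.
    - by move=> i; rewrite /g; case: ifP.
    - by move=> i x; rewrite /g; case: ifP.
    - move=> i; rewrite /g; case: ifP => _; last exact: ff.
      rewrite (@integral_indic_comp _ _ _ _ _ _ (X i) B mB).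
      by apply: (fin_num_measure P); exact: measurable_funPTI.
    - move=> i iJ si; have [->|ij] := eqVneq i j; first by exists B.
      by rewrite gi//; apply: fB => //; rewrite inE negb_or ij.
  rewrite (bigD1_seq j)//= gj.
  under [in RHS]eq_bigr => i ij do rewrite gi//.
  rewrite -/c => gE.
  transitivity (\int[P]_w (\prod_(i <- J) g i (X i w))%:E)%E.
    apply: eq_integral => w _; rewrite (bigD1_seq j)//= gj; congr (_ * _)%:E.
    by apply: eq_bigr => i ij; rewrite gi.
  rewrite gE -{1}(fineK cfin); under [RHS]eq_integral do rewrite mulrC EFinM.
  rewrite ge0_integralZl ?lee_fin ?fine_ge0//.
  - by rewrite muleC.
  - by apply/measurable_EFinP; exact: measurableT_comp (mindic _ mB) _.
have := @eq_integral_comp_mul _ _ _ _ _ P (X j) V (cst (fine c)) (EFin \o f j).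
rewrite (bigD1_seq j)//= -/c => /(_ _ _ _ _ _ _ VB) fVc.
transitivity (\int[P]_w ((f j (X j w))%:E * (V w)%:E))%E.
  by apply: eq_integral => w _; rewrite (bigD1_seq j).
rewrite fVc//; last 3 first.
- exact/measurable_EFinP.
- by move=> x; rewrite lee_fin.
- by move=> w; exact: fine_ge0.
under eq_integral do rewrite fineK// muleC.
rewrite ge0_integralZl// 1?muleC//.
- exact/measurable_EFinP.
- by move=> w _; rewrite lee_fin.
Qed.

(** * Exponential moments and the Chernoff bound *)

(** From exp(-x) >= 1 - x one gets (1 - x) exp(x) <= 1, while (1 - x)(1 + x + 2 x^2) = 1 + x^2 (1 -
    2 x) >= 1. *)
Lemma expR_le_quadratic (R : realType) (x : R) :
  x <= 2^-1 -> expR x <= 1 + x + 2 * x ^+ 2.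
Proof.
move=> x2; have x1 : 0 < 1 - x by lra.
have e1 : (1 - x) * expR x <= 1.
  rewrite -[x in expR x]opprK expRN ler_pdivrMr ?expR_gt0// mul1r.
  exact: expR_ge1Dx.
rewrite -(ler_pM2l x1) (le_trans e1)//.
have : 0 <= x ^+ 2 * (1 - 2 * x) by rewrite mulr_ge0 ?sqr_ge0//; lra.
rewrite expr2; nra.
Qed.

(** A form of Hoeffding's lemma with a cruder constant, for small [l]: in the quadratic bound for
    exp(l Y) the linear term has mean zero, and 1 + y <= exp(y) finishes. *)
Lemma integral_expR_le d (T : measurableType d) (R : realType)
    (P : probability T R) (Y : T -> R) (l c : R) :
  measurable_fun [set: T] Y -> (forall w, `|Y w| <= c) ->
  (\int[P]_w (Y w)%:E = 0)%E -> 0 <= l -> l * c <= 2^-1 ->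
  (\int[P]_w (expR (l * Y w))%:E <= (expR (2 * (l * c) ^+ 2))%:E)%E.
Proof.
move=> mY Yc EY0 l0 lc.
have intY : P.-integrable [set: T] (EFin \o Y).
  apply: measurable_bounded_integrable => //; first exact: fin_num_fun_lty.
  exists c; split; first exact: num_real.
  by move=> r cr w _ /=; rewrite (le_trans (Yc w))// ltW.
pose C := 1 + 2 * (l * c) ^+ 2.
have intC : P.-integrable [set: T] (EFin \o cst C).
  exact: finite_measure_integrable_cst.
apply: (@le_trans _ _ (\int[P]_w (C%:E + l%:E * (Y w)%:E))%E); last first.
  rewrite integralD//=; last exact: integrableZl.
  rewrite integral_cst// [X in (_ * X)%E]probability_setT mule1.
  rewrite integralZl// EY0 mule0 adde0.
  by rewrite lee_fin expR_ge1Dx.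
apply: ge0_le_integral => //.
- apply/measurable_EFinP; apply: measurableT_comp => //.
  exact: measurable_funM.
- apply/measurable_EFinP; apply: measurable_funD => //.
  exact: measurable_funM.
move=> w _; rewrite -EFinM -EFinD lee_fin.
have /ler_normlP[cY1 cY2] := Yc w.
have Ylc : l * Y w <= l * c by exact: ler_wpM2l.
apply: (le_trans (expR_le_quadratic _)); first exact: le_trans lc.
rewrite /C addrAC lerD2r lerD2l ler_pM2l// !exprMn ler_wpM2l ?sqr_ge0//.
by rewrite -(real_normK (num_real (Y w))) ler_sqr ?nnegrE// (le_trans _ (Yc w)).
Qed.

(** Both integrals are taken against the laws of the variables, which agree on measurable sets;
    positive and negative parts are treated separately. *)
Lemma eq_integral_identically_distributed d (T : measurableType d)
    (R : realType) (P : probability T R) (I : Type) (X : I -> {RV P >-> R})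
    (i j : I) (f : R -> R) :
  identically_distributed X -> measurable_fun [set: R] f ->
  (\int[P]_w (f (X i w))%:E = \int[P]_w (f (X j w))%:E)%E.
Proof.
move=> idd mf.
have ge0E (g : R -> \bar R) : measurable_fun [set: R] g ->
    (forall x, 0 <= g x)%E ->
    (\int[P]_w g (X i w) = \int[P]_w g (X j w))%E.
  move=> mg g0.
  rewrite -!(ge0_integral_distribution _ mg)//.
  by apply: eq_measure_integral => A mA _; exact: idd.
have mF : measurable_fun [set: R] (EFin \o f) by exact/measurable_EFinP.
rewrite integralE [RHS]integralE; congr (_ - _)%E.
  rewrite (funepos_comp (EFin \o f) (X i)) (funepos_comp (EFin \o f) (X j)).
  exact: (ge0E _ (measurable_funepos mF) (fun x => funepos_ge0 _ x)).
rewrite (funeneg_comp (EFin \o f) (X i)) (funeneg_comp (EFin \o f) (X j)).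
exact: (ge0E _ (measurable_funeneg mF) (fun x => funeneg_ge0 _ x)).
Qed.

(** Links products over ordinals, as in partial sums, to products over finite sets, as in the
    definition of independence. *)
Lemma prodr_fset_ord (R : comPzSemiRingType) (F : nat -> R) k :
  \prod_(i < k) F i = \prod_(i <- seq_fset tt (iota 0 k)) F i.
Proof.
rewrite -(big_mkord xpredT) /index_iota subn0; apply/perm_big/uniq_perm.
- exact: iota_uniq.
- exact: fset_uniq.
- by move=> i; rewrite seq_fsetE.
Qed.

(** Markov's inequality for exp(l S), with S the sum: independence factors its expectation, and each
    factor is at most exp(2 (l c)^2). *)
Lemma sum_tail d (T : measurableType d) (R : realType) (P : probability T R)
    (X : nat -> {RV P >-> R}) (h : R -> R) (c e : R) (k : nat) :
  mutually_independent X -> identically_distributed X ->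
  measurable_fun [set: R] h -> (forall x, `|h x| <= c) ->
  (\int[P]_w (h (X 0%N w))%:E = 0)%E -> 0 < c -> 0 <= e <= 2 * c ->
  (P [set w | (k%:R * e <= \sum_(i < k) h (X i w))%R] <=
   (expR (- (k%:R * e ^+ 2 / (8 * c ^+ 2))))%:E)%E.
Proof.
move=> indep idd mh hc Eh0 c0 /andP[e0 ec].
(* This l makes [2 (l c)^2 - l e] equal to [- e^2 / (8 c^2)]. *)
pose l := e / (4 * c ^+ 2).
have l0 : 0 <= l by rewrite divr_ge0// mulr_ge0// sqr_ge0.
(* Here [e <= 2 * c] enters, since l c = e / (4 c). *)
have lc : l * c <= 2^-1.
  rewrite (_ : l * c = e / (4 * c)); last by rewrite /l; field; rewrite gt_eqF.
  by rewrite ler_pdivrMr ?mulr_gt0//; lra.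
have mg : measurable_fun [set: R] (fun x => expR (l * h x)).
  by apply: measurableT_comp => //; exact: measurable_funM.
set A := [set w | _].
have mS : measurable_fun [set: T] (fun w => \sum_(i < k) h (X i w)).
  by apply: measurable_sum => i; exact: measurableT_comp.
have mA : measurable A.
  rewrite -[A]setTI.
  by apply: (measurable_fun_le measurableT (f := cst (k%:R * e))).
have mgf i : (\int[P]_w (expR (l * h (X i w)))%:E <=
    (expR (2 * (l * c) ^+ 2))%:E)%E.
  apply: (@integral_expR_le _ _ _ _ (fun w => h (X i w))) => //.
    exact: measurableT_comp.
  rewrite -[RHS]Eh0.
  exact: (@eq_integral_identically_distributed _ _ _ P nat X i 0%N h).
have mgf0 i : (0 <= \int[P]_w (expR (l * h (X i w)))%:E)%E.
  by apply: integral_ge0 => w _; rewrite lee_fin expR_ge0.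
have Eprod : (\int[P]_w (expR (l * \sum_(i < k) h (X i w)))%:E <=
              (expR (2 * (l * c) ^+ 2) ^+ k)%:E)%E.
  have -> : (\int[P]_w (expR (l * \sum_(i < k) h (X i w)))%:E =
            \prod_(i <- seq_fset tt (iota 0 k))
              \int[P]_w (expR (l * h (X i w)))%:E)%E.
    rewrite -(@expectation_prod _ _ _ P _ X (fun _ x => expR (l * h x)))//.
    - apply: eq_integral => w _; congr (_%:E).
      rewrite mulr_sumr expR_sum.
      exact: (prodr_fset_ord (fun i => expR (l * h (X i w)))).
    - move=> i; rewrite ge0_fin_numE//; apply: le_lt_trans (mgf i) _.
      exact: ltry.
  have -> : (expR (2 * (l * c) ^+ 2) ^+ k)%:E =
      (\prod_(i <- seq_fset tt (iota 0 k)) (expR (2 * (l * c) ^+ 2))%:E)%E.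
    rewrite prodEFin -(prodr_fset_ord (fun=> expR (2 * (l * c) ^+ 2))).
    by rewrite prodr_const card_ord.
  (* Nonnegativity is carried along with the inequality, because multiplying inequalities requires
     nonnegative factors. *)
  apply: proj2; apply/andP.
  apply: (big_ind2 (fun x y => 0 <= x <= y)%E) => [|x1 x2 y1 y2|i _].
  - by rewrite lexx lee_fin ler01.
  - move=> /andP[x10 x12] /andP[y10 y12].
    by rewrite mule_ge0//= lee_pmul.
  - by rewrite mgf0 mgf.
(* Markov's inequality, from the pointwise bound of exp(l k e) times the indicator of [A] by exp(l
   S). *)
have step : ((expR (l * (k%:R * e)))%:E * P A <=
    (expR (2 * (l * c) ^+ 2) ^+ k)%:E)%E.
  apply: le_trans Eprod.
  rewrite -(setIT A) -integral_indic// -ge0_integralZl//;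
    last exact/measurable_EFinP.
  apply: ge0_le_integral => //.
  - apply/measurable_EFinP; exact: measurable_funM.
  - apply/measurable_EFinP; apply: measurableT_comp => //.
    exact: measurable_funM.
  move=> w _; rewrite -EFinM lee_fin indicE.
  have [/set_mem|] := boolP (w \in A).
    by rewrite /A/= mulr1 ler_expR; exact: ler_wpM2l.
  by rewrite mulr0 expR_ge0.
rewrite -(lee_pmul2l _ _ (x := (expR (l * (k%:R * e)))%:E))//; last first.
  by rewrite lte_fin expR_gt0.
rewrite (le_trans step)// -EFinM lee_fin -expRM_natl -expRD ler_expR.
rewrite le_eqVlt; apply/orP; left; apply/eqP; rewrite /l; field.
by rewrite gt_eqF.
Qed.

(** * Summability, Borel-Cantelli and transfer of almost sure events *)

(** The term x^m / m! of the exponential series bounds exp(x) from below. At x = (k+1)^s / K with s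
    m >= 2 it dominates a multiple of (k+1)^2. *)
Lemma expRN_powR_le_sqr (R : realType) (s K : R) : 0 < s -> 0 < K ->
  exists2 C, 0 <= C &
    forall k : nat, expR (- (k.+1%:R `^ s / K)) <= C / k.+1%:R ^+ 2.
Proof.
move=> s0 K0; pose n := Num.truncn (2 / s); pose m := n.+1.
have sm : 2 <= s * m%:R.
  by rewrite mulrC -ler_pdivrMr// ltW// /m truncnS_gt.
exists (m`!%:R * K ^+ m) => [|k]; first by rewrite mulr_ge0// exprn_ge0// ltW.
set x := _ / K.
have x0 : 0 < x by rewrite divr_gt0// powR_gt0.
have xm : k.+1%:R ^+ 2 / (m`!%:R * K ^+ m) <= expR x.
  apply: le_trans (expR_ge1Dxn n (ltW x0)).
  rewrite -[leLHS]add0r lerD// -/m /x expr_div_n.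
  rewrite -[(_ `^ s) ^+ m]powR_mulrn ?powR_ge0//.
  rewrite -powRrM -(mulrA _ (K ^+ m)^-1) -invfM (mulrC (K ^+ m)).
  rewrite ler_pM2r; last first.
    by rewrite invr_gt0 mulr_gt0// ?exprn_gt0// ltr0n fact_gt0.
  by rewrite -powR_mulrn//; apply: ler_powR => //; rewrite ler1n.
rewrite expRN -[leRHS]invrK lef_pV2 ?posrE ?expR_gt0//.
  by rewrite invf_div.
rewrite invr_gt0 divr_gt0// ?exprn_gt0//.
by rewrite mulr_gt0// ?exprn_gt0// ltr0n fact_gt0.
Qed.

(** Since 1/(k+1)^2 <= 2 (1/(k+1) - 1/(k+2)), telescoping bounds all partial sums by 2 C. *)
Lemma nneseries_lty_of_le_sqr (R : realType) (u : nat -> \bar R) (C : R) :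
  0 <= C -> (forall k, 0 <= u k)%E ->
  (forall k, u k <= (C / k.+1%:R ^+ 2)%:E)%E -> (\sum_(k <oo) u k < +oo)%E.
Proof.
move=> C0 u0 uC; apply: (@le_lt_trans _ _ (2 * C)%:E); last exact: ltry.
apply: lime_le; first exact: is_cvg_nneseries.
apply: nearW => n /=.
apply: (@le_trans _ _
  (\sum_(0 <= k < n) (2 * C * (k.+1%:R^-1 - k.+2%:R^-1))%:E)%E).
  apply: lee_sum => k _; apply: le_trans (uC k) _; rewrite lee_fin.
  rewrite (mulrC 2) -mulrA; apply: ler_wpM2l => //.
  have k1 : 0 < k.+1%:R :> R by rewrite ltr0n.
  have -> : 2 * (k.+1%:R^-1 - k.+2%:R^-1) = 2 / (k.+1%:R * k.+2%:R) :> R.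
    by rewrite -(natr1 k.+1); field; rewrite !gt_eqF// ltr_wpDr.
  rewrite ler_pdivlMr ?mulr_gt0// -natr1.
  rewrite mulrC ler_pdivrMr ?exprn_gt0// -natr1; have := ler0n R k; nra.
rewrite sumEFin lee_fin -mulr_sumr.
rewrite (telescope_sumr_eq (fun k => - k.+1%:R^-1)) => // [|k _]; last first.
  by rewrite opprK addrC.
by rewrite invr1 opprK ler_piMr ?mulr_ge0// addrC lerBlDr lerDl.
Qed.

(** The first Borel-Cantelli lemma, read off the complement of the null set [lim_sup_set F]. *)
Lemma ae_eventually_notin d (T : measurableType d) (R : realType)
    (mu : {measure set T -> \bar R}) (F : (set T)^nat) :
  (forall k, measurable (F k)) -> (\sum_(k <oo) mu (F k) < +oo)%E ->
  {ae mu, forall w, exists N, forall k, (N <= k)%N -> ~ F k w}.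
Proof.
move=> mF sF; exists (lim_sup_set F); split.
- apply: bigcapT_measurable => n; exact: bigcup_measurable.
- exact: lim_sup_set_cvg0.
move=> w /= nw n _; apply: contrapT => nF; apply: nw; exists n => k nk Fk.
by apply: nF; exists k.
Qed.

(** Each almost sure statement says that the law of the variable vanishes on the complement of [B].
    This carries the bounds assumed for [X 0] to every [X i]. *)
Lemma ae_identically_distributed d (T : measurableType d) (R : realType)
    (P : probability T R) (I : Type) (X : I -> {RV P >-> R}) (i j : I)
    (B : set R) :
  identically_distributed X -> measurable B ->
  {ae P, forall w, B (X i w)} -> {ae P, forall w, B (X j w)}.
Proof.
move=> idd mB; have mC : measurable (~` B) by exact: measurableC.
have H k : {ae P, forall w, B (X k w)} <-> distribution P (X k) (~` B) = 0%E.
  have := @negligibleP _ _ _ P (X k @^-1` (~` B)) (measurable_funPTI _ mC).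
  by [].
by rewrite !H (idd j i).
Qed.

(** * Two-sided tails and the almost sure rate *)

(** A union bound over the one-sided tails of [h] and [- h], whence the factor 2. *)
Lemma sum_abs_tail d (T : measurableType d) (R : realType)
    (P : probability T R) (X : nat -> {RV P >-> R}) (h : R -> R) (c e : R)
    (k : nat) :
  mutually_independent X -> identically_distributed X ->
  measurable_fun [set: R] h -> (forall x, `|h x| <= c) ->
  (\int[P]_w (h (X 0%N w))%:E = 0)%E -> 0 < c -> 0 <= e <= 2 * c ->
  (P [set w | (k%:R * e <= `|\sum_(i < k) h (X i w)|)%R] <=
   (2 * expR (- (k%:R * e ^+ 2 / (8 * c ^+ 2))))%:E)%E.
Proof.
move=> indep idd mh hc Eh0 c0 ec.
have mS (f : R -> R) : measurable_fun [set: R] f ->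
    measurable [set w | k%:R * e <= \sum_(i < k) f (X i w)].
  move=> mf; rewrite -[X in measurable X]setTI.
  apply: (measurable_fun_le measurableT (f := cst (k%:R * e))) => //.
  by apply: measurable_sum => i; exact: measurableT_comp.
have mN : measurable_fun [set: R] (fun x => - h x) by exact: measurableT_comp.
have h1 := sum_tail k indep idd mh hc Eh0 c0 ec.
have h2 : (P [set w | (k%:R * e <= \sum_(i < k) - h (X i w))%R] <=
   (expR (- (k%:R * e ^+ 2 / (8 * c ^+ 2))))%:E)%E.
  apply: (@sum_tail _ _ _ P X (fun x => - h x) c e k) => //.
    by move=> x; rewrite normrN.
  under eq_integral do rewrite -mulN1r EFinM.
  rewrite integralZl ?Eh0 ?mule0//.
  apply: measurable_bounded_integrable => //; first exact: fin_num_fun_lty.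
    exact: measurableT_comp.
  exists c; split; first exact: num_real.
  by move=> r cr w _ /=; rewrite (le_trans (hc _))// ltW.
apply: (@le_trans _ _ (P ([set w | (k%:R * e <= \sum_(i < k) h (X i w))%R] `|`
   [set w | (k%:R * e <= \sum_(i < k) - h (X i w))%R]))%E).
  apply: le_measure.
  - rewrite inE -[X in measurable X]setTI.
    apply: (measurable_fun_le measurableT (f := cst (k%:R * e))) => //.
    apply: measurableT_comp => //; apply: measurable_sum => i.
    exact: measurableT_comp.
  - by rewrite inE; apply: measurableU; [exact: (mS _ mh)|exact: (mS _ mN)].
  - move=> w /=; rewrite sumrN ler_normr => /orP[]; by [left|right].
apply: le_trans (measureU2 _ (mS _ mh) (mS _ mN)) _.
by rewrite mulrDl mul1r EFinD leeD.
Qed.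

Lemma ae_bounded_slln_rate d (T : measurableType d) (R : realType)
    (P : probability T R) (X : nat -> {RV P >-> R}) (h : R -> R) (c t : R) :
  mutually_independent X -> identically_distributed X ->
  measurable_fun [set: R] h -> (forall x, `|h x| <= c) -> 1 <= c ->
  (\int[P]_w (h (X 0%N w))%:E = 0)%E -> 2 < t ->
  {ae P, forall w, exists N, forall k, (N < k)%N ->
     `|\sum_(i < k) h (X i w)| < k%:R * k%:R `^ (- t^-1)}.
Proof.
move=> indep idd mh hc c1 Eh0 t2.
have t0 : 0 < t by lra.
pose e k : R := k%:R `^ (- t^-1).
(* The shift to [k.+1] excludes the empty sum, for which the strict inequality would read 0 < 0. *)
pose F k := [set w | k.+1%:R * e k.+1 <= `|\sum_(i < k.+1) h (X i w)|].
have c0 : 0 < c by exact: lt_le_trans c1.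
have mF k : measurable (F k).
  rewrite -[F k]setTI.
  apply: (measurable_fun_le measurableT (f := cst (k.+1%:R * e k.+1))) => //.
  apply: measurableT_comp => //; apply: measurable_sum => i.
  exact: measurableT_comp.
have s0 : 0 < 1 - 2 / t by rewrite subr_gt0 ltr_pdivrMr// mul1r.
have K0 : 0 < 8 * c ^+ 2 by rewrite mulr_gt0// exprn_gt0.
have [C C0 HC] := expRN_powR_le_sqr s0 K0.
have PF k : (P (F k) <= (2 * C / k.+1%:R ^+ 2)%:E)%E.
  (* The deviation is at most 1, so [1 <= c] puts it in the range of the tail bound. *)
  have e01 : 0 <= e k.+1 <= 2 * c.
    rewrite powR_ge0/= (@le_trans _ _ 1)//; last by lra.
    rewrite -(powRr0 k.+1%:R); apply: ler_powR; first by rewrite ler1n.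
    by rewrite oppr_le0 invr_ge0 ltW.
  apply: le_trans (sum_abs_tail k.+1 indep idd mh hc Eh0 c0 e01) _.
  rewrite lee_fin -[leRHS]mulrA ler_pM2l// (le_trans _ (HC k))// ler_expR.
  rewrite lerN2 ler_pM2r ?invr_gt0 ?mulr_gt0 ?exprn_gt0//.
  (* The exponents are in fact equal: (k+1) e^2 = (k+1)^(1 - 2/t). *)
  rewrite le_eqVlt; apply/orP; left; apply/eqP.
  rewrite /e -powR_mulrn ?powR_ge0// -powRrM powRD ?pnatr_eq0 ?implybT//.
  by rewrite powRr1// mulNr (mulrC 2).
have := @ae_eventually_notin _ _ _ P F mF (nneseries_lty_of_le_sqr _ _ PF).
have C20 : 0 <= 2 * C by rewrite mulr_ge0.
move=> /(_ C20 (fun k => measure_ge0 P (F k))).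
apply: filterS => w [N HN]; exists N => -[//|k]; rewrite ltnS => Nk.
by have /negP := HN k Nk; rewrite -ltNge.
Qed.

(** * The property at a single exponent *)

(** The body of [averages_converge_fast] at one [t], isolated so that the real quantifier over [t]
    can be replaced by a countable one. *)
Definition converges_at_rate (R : realType) (x : nat -> R) (m t : R) : Prop :=
  exists M : nat, (0 < M)%N /\
    forall n k : nat, (M <= n)%N -> (0 < k)%N -> n%:R `^ t <= k%:R ->
      `| k%:R^-1 * (\sum_(i < k) x i) - m | < n%:R^-1.

(** As n >= M >= 1, a larger exponent raises the threshold n^t and leaves fewer [k] to check. *)
Lemma converges_at_rate_le (R : realType) (x : nat -> R) (m t t' : R) :
  t <= t' -> converges_at_rate x m t -> converges_at_rate x m t'.
Proof.
move=> tt' [M [M0 HM]]; exists M; split => // n k Mn k0 nk.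
apply: HM => //; apply: le_trans nk; apply: ler_powR => //.
by rewrite ler1n (leq_trans M0).
Qed.

Lemma averages_converge_fastE (R : realType) (x : nat -> R) (m : R) :
  averages_converge_fast x m <->
  forall j : nat, converges_at_rate x m (2 + j.+1%:R^-1).
Proof.
split => [H j|H t t2]; first by apply: H; rewrite ltrDl invr_gt0.
(* This makes j + 1 > 1/(t - 2), so that 2 + 1/(j+1) lies below [t]. *)
pose j := Num.truncn (t - 2)^-1.
apply: (@converges_at_rate_le _ _ _ (2 + j.+1%:R^-1)) (H j).
have t20 : 0 < t - 2 by rewrite subr_gt0.
rewrite addrC -lerBrDr -[leRHS]invrK lef_pV2 ?posrE ?invr_gt0 ?ltr0n//.
exact/ltW/truncnS_gt.
Qed.

(** With [t] fixed, all quantifiers range over naturals, so the set is a countable union of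
    countable intersections. *)
Lemma measurable_converges_at_rate d (T : measurableType d) (R : realType)
    (X : nat -> T -> R) (m t : R) :
  (forall i, measurable_fun [set: T] (X i)) ->
  measurable [set w | converges_at_rate (fun i => X i w) m t].
Proof.
move=> mX.
rewrite (_ : [set w | _] = \bigcup_(M in [set M | (0 < M)%N])
  \bigcap_(n in [set n | (M <= n)%N])
  \bigcap_(k in [set k | (0 < k)%N /\ n%:R `^ t <= k%:R])
    [set w | `| k%:R^-1 * (\sum_(i < k) X i w) - m | < n%:R^-1]); last first.
  apply/seteqP; split => w /= [M].
    by move=> [M0 H]; exists M => // n Mn k [k0 nk]; exact: H.
  by move=> M0 H; exists M; split => // n k Mn k0 nk; exact: (H n Mn k).
apply: bigcup_measurable => M _; apply: bigcap_measurableType => n _.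
apply: bigcap_measurableType => k _.
have mS : measurable_fun [set: T]
    (fun w => `| k%:R^-1 * (\sum_(i < k) X i w) - m |).
  apply: measurableT_comp => //; apply: measurable_funB => //.
  by apply: measurable_funM => //; exact: measurable_sum.
have := measurable_fun_ltr mS (measurable_cst (n%:R^-1 : R)) measurableT.
by move=> /(_ [set true]); rewrite setTI; exact.
Qed.

(** If k >= n^t then k^(-1/t) <= 1/n; moreover t >= 1 gives k >= n, so [k] exceeds [N] as soon as
    [n] does. *)
Lemma converges_at_rate_of_deviation (R : realType) (x : nat -> R) (m t : R) :
  1 <= t ->
  (exists N, forall k, (N < k)%N ->
    `|\sum_(i < k) (x i - m)| < k%:R * k%:R `^ (- t^-1)) ->
  converges_at_rate x m t.
Proof.
move=> t1 [N HN]; have t0 : 0 < t by exact: lt_le_trans t1.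
exists N.+1; split => // n k Nn k0 nk.
have n0 : (0 < n)%N by exact: leq_trans Nn.
have kR0 : 0 < k%:R :> R by rewrite ltr0n.
have nk' : (n <= k)%N.
  rewrite -(ler_nat R); apply: le_trans nk.
  by apply: le1r_powR => //; rewrite ler1n.
have -> : k%:R^-1 * \sum_(i < k) x i - m = k%:R^-1 * \sum_(i < k) (x i - m).
  rewrite sumrB sumr_const card_ord mulrBr -[m *+ k]mulr_natl.
  rewrite mulrA mulVf ?mul1r//.
  by rewrite gt_eqF.
rewrite normrM gtr0_norm ?invr_gt0// mulrC ltr_pdivrMr//.
apply: lt_le_trans (HN k (leq_trans Nn nk')) _.
rewrite mulrC ler_pM2r// powRN lef_pV2 ?posrE ?powR_gt0 ?ltr0n//.
have -> : n%:R = (n%:R `^ t) `^ t^-1 :> R.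
  by rewrite -powRrM divff ?gt_eqF// powRr1.
by apply: ge0_ler_powR; rewrite ?invr_ge0 ?nnegrE ?powR_ge0 ?(ltW t0).
Qed.

(** * Reduction to clipped, centred variables and conclusion *)

Theorem theorem24 (d : measure_display) (T : measurableType d) (R : realType)
    (P : probability T R) (X : nat -> {RV P >-> R})
    (Xindep : mutually_independent X) (Xid : identically_distributed X)
    (a b : R) (ltab : a < b)
    (Xbounded : {ae P, forall w, a <= X 0%N w <= b}) :
  let good (w : T) :=
    averages_converge_fast (fun i => X i w) (fine ('E_P[X 0%N])%E) in
  measurable [set w | good w] /\ {ae P, forall w, good w}.
Proof.
move=> good; pose m := fine ('E_P[X 0%N])%E.
have goodE w : good w <->
    forall j : nat, converges_at_rate (fun i => X i w) m (2 + j.+1%:R^-1).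
  exact: averages_converge_fastE.
split.
  rewrite (_ : [set w | _] = \bigcap_j
      [set w | converges_at_rate (fun i => X i w) m (2 + j.+1%:R^-1)]).
    by apply: bigcapT_measurable => j; exact: measurable_converges_at_rate.
  apply/seteqP; split => w; first by move=> /goodE H j _; exact: H.
  by move=> H; apply/goodE => j; exact: H.
(* Clipping acts on values, so the clipped variables are one fixed function of the [X i], as the
   lemmas on [h (X i w)] require. *)
pose clip x : R := Num.max a (Num.min b x).
have mclip : measurable_fun [set: R] clip.
  by apply: measurable_maxr => //; exact: measurable_minr.
have clipab x : a <= clip x <= b.
  by rewrite /clip le_max lexx/= ge_max (ltW ltab)/= ge_min lexx.
have clip_id x : a <= x <= b -> clip x = x.
  by move=> /andP[ax xb]; rewrite /clip (min_idPr xb) (max_idPr ax).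
pose B : R := `|a| + `|b|.
have clipB x : `|clip x| <= B.
  have /andP[h1 h2] := clipab x; rewrite /B.
  have := ler_norm b; have := ler_norm (- a); rewrite normrN.
  have := normr_ge0 a; have := normr_ge0 b.
  by rewrite ler_norml => *; apply/andP; split; lra.
have intclip : P.-integrable [set: T] (fun w => (clip (X 0%N w))%:E).
  apply: measurable_bounded_integrable => //; first exact: fin_num_fun_lty.
    exact: measurableT_comp.
  exists B; split; first exact: num_real.
  by move=> r cr w _ /=; rewrite (le_trans (clipB _))// ltW.
have mE : (\int[P]_w (clip (X 0%N w))%:E = m%:E)%E.
  rewrite -[LHS]fineK; last exact: integrable_fin_num.
  congr (fine _)%:E; rewrite unlock; apply: ae_eq_integral => //.
  - exact/measurable_EFinP/measurableT_comp.
  - exact/measurable_EFinP.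
  - by apply: filterS Xbounded => w /clip_id + _ => ->.
pose h x := clip x - m.
have mh : measurable_fun [set: R] h by exact: measurable_funB.
(* The added 1 provides the lower bound [1 <= c] that the rate lemma asks for. *)
have hc x : `|h x| <= B + `|m| + 1.
  rewrite (le_trans (ler_normB _ _))// -addrA lerD//.
  by rewrite lerDl.
have Eh0 : (\int[P]_w (h (X 0%N w))%:E = 0)%E.
  rewrite /h; under eq_integral do rewrite EFinB.
  rewrite integralB//= ?mE; last exact: finite_measure_integrable_cst.
  by rewrite integral_cst// [X in (_ * X)%E]probability_setT mule1 subee.
have Xab i : {ae P, forall w, X i w \in `[a, b]}.
  apply: (@ae_identically_distributed _ _ _ P _ X 0%N i [set` `[a, b]]) => //.
have rate j : {ae P, forall w, exists N, forall k, (N < k)%N ->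
     `|\sum_(i < k) h (X i w)| < k%:R * k%:R `^ (- (2 + j.+1%:R^-1)^-1)}.
  apply: (ae_bounded_slln_rate Xindep Xid mh hc) => //.
  - by rewrite lerDr /B !addr_ge0.
  - by rewrite ltrDl invr_gt0.
(* Two countable families of null sets are discarded: one for the bounds on the [X i], one for the
   rates at the exponents 2 + 1/(j+1). *)
have := ae_foralln rate; have := ae_foralln Xab.
apply: filterS2 => w Xw Hw; apply/goodE => j.
apply: converges_at_rate_of_deviation.
  by rewrite -[leLHS]addr0 lerD// ?ler1n// invr_ge0.
have [N HN] := Hw j; exists N => k Nk; have := HN k Nk.
suff -> : \sum_(i < k) (X i w - m) = \sum_(i < k) h (X i w) by [].
by apply: eq_bigr => i _; rewrite /h clip_id//; exact: Xw.
Qed.
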